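(* Let $d\ge 3$ and let $p_1,\dots,p_d$ be the slopes of an implicit $d$-web on an open set $U\subset\mathbb{C}^2$. Then there exist functions $g_1,\dots,g_d,h_1,\dots,h_d$ on $U$, depending only on the slopes $p_1,\dots,p_d$, such that the system of $d$ equations in the unknown analytic functions $\alpha_1,\alpha_2$ $$-\alpha_1\,\partial_x(p_i)-\alpha_2\,\partial_y(p_i)+\partial_x(\alpha_2)+\bigl(\partial_y(\alpha_2)-\partial_x(\alpha_1)\bigr)p_i-\partial_y(\alpha_1)\,p_i^2=0,\qquad i=1,\dots,d,$$ can be written equivalently (i.e. has the same solutions $(\alpha_1,\alpha_2)$) in the normalized form $$\left\{\begin{array}{l} -\partial_x(\alpha_2)+g_d\,\alpha_1+h_d\,\alpha_2=0,\\ \partial_x(\alpha_1)-\partial_y(\alpha_2)+g_{d-1}\,\alpha_1+h_{d-1}\,\alpha_2=0,\\ \partial_y(\alpha_1)+g_{d-2}\,\alpha_1+h_{d-2}\,\alpha_2=0,\\ g_{d-3}\,\alpha_1+h_{d-3}\,\alpha_2=0,\\ \qquad\vdots\\ g_1\,\alpha_1+h_1\,\alpha_2=0 \end{array}\right.$$ (for $d=3$ only the first three equations are present).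
   Context: The slopes $p_1,\dots,p_d$ of an implicit $d$-web are the roots in $z$ of a polynomial $P_F(z;x,y)=a_0(x,y)z^d+\cdots+a_d(x,y)$ with analytic coefficients, considered on an open set $U\subset\mathbb{C}^2$ where the resultant of $P_F$ and $\partial_zP_F$ does not vanish and where the roots are given by analytic functions $p_1,\dots,p_d$; in particular the $p_i$ are pairwise distinct at every point of $U$. The first displayed system is the system of equations characterizing the infinitesimal symmetries $\alpha_1\partial_x+\alpha_2\partial_y$ of the web formed by the $d$ foliations by integral curves of $y'=p_i(x,y)$. ''Depending only on the slopes'' means that $g_i,h_i$ are determined by the functions $p_1,\dots,p_d$ (through their values and partial derivatives), independently of $\alpha_1,\alpha_2$. *)

(* Defs.v *)
From mathcomp Require Import all_boot all_order all_algebra.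
From mathcomp Require Import all_classical all_reals all_analysis.
From mathcomp Require Import complex.

Set Implicit Arguments.
Unset Strict Implicit.
Unset Printing Implicit Defensive.

Import Order.TTheory GRing.Theory Num.Theory numFieldNormedType.Exports.

Local Open Scope classical_set_scope.
Local Open Scope ring_scope.

(* The regular module [T^o] is what carries the normed-space structure when
   [T] is the concrete type [R[i]]. *)
Notation plane T := (T^o * T^o)%type.

Section Web.
Variable K : numFieldType.
Implicit Types (U : set (plane K)) (z w : plane K) (f : plane K -> K).

Definition partial_x f z : K := 'D_(1, 0) (f : plane K -> K^o) z.
Definition partial_y f z : K := 'D_(0, 1) (f : plane K -> K^o) z.

(* [f] is the sum of an absolutely convergent double power series on a
   polydisc around [z]. When [K] is R[i], [0 < r] forces [r] to be real. *)
Definition analytic_at f z : Prop :=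
  exists2 r : K, 0 < r & exists c : nat -> nat -> K,
    forall w, `|w.1 - z.1| < r -> `|w.2 - z.2| < r ->
      let term i j : K := c i j * (w.1 - z.1) ^+ i * (w.2 - z.2) ^+ j in
      (exists M : K, forall n, \sum_(i < n) \sum_(j < n) `|term i j| <= M) /\
      ((\sum_(i < n) \sum_(j < n) term i j : K^o) @[n --> \oo] --> (f w : K^o)).

Definition analytic_on U f : Prop := forall z, U z -> analytic_at f z.

(* [P] is a polynomial in the slope variable whose coefficients are functions
   of (x, y), its coefficient of degree [d - k] being a_k.  The resultant is
   taken over the ring of functions, hence with formal degrees d and d-1, and
   is then evaluated at a point; its nonvanishing at [z] forces a_0(z) != 0. *)
Definition implicit_web (d : nat) U (P : {poly (plane K -> K)}) : Prop :=
  [/\ open U,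
      size P = d.+1,
      forall k, analytic_on U P`_k
    & forall z, U z -> resultant P P^`() z != 0].

(* The roots are counted with multiplicity; that the [p i z] are pairwise
   distinct follows from the resultant condition of [implicit_web]. *)
Definition slopes (d : nat) U (P : {poly (plane K -> K)})
    (p : 'I_d -> plane K -> K) : Prop :=
  (forall i, analytic_on U (p i)) /\
  (forall z, U z ->
     map_poly (fun a : plane K -> K => a z) P =
     P`_d z *: \prod_(i < d) ('X - (p i z)%:P)).

Definition symmetry_eq (p a1 a2 : plane K -> K) z : Prop :=
  - a1 z * partial_x p z - a2 z * partial_y p z + partial_x a2 z
  + (partial_y a2 z - partial_x a1 z) * p z - partial_y a1 z * p z ^+ 2 = 0.

(* Only the indices 1, ..., d of [g] and [h] are used. *)
Definition normalized_system (d : nat) (g h : nat -> plane K -> K)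
    (a1 a2 : plane K -> K) z : Prop :=
  [/\ - partial_x a2 z + g d z * a1 z + h d z * a2 z = 0,
      partial_x a1 z - partial_y a2 z
        + g (d - 1)%N z * a1 z + h (d - 1)%N z * a2 z = 0,
      partial_y a1 z + g (d - 2)%N z * a1 z + h (d - 2)%N z * a2 z = 0
    & forall k, (1 <= k <= d - 3)%N -> g k z * a1 z + h k z * a2 z = 0].

(* The function on the plane obtained by applying [F] at each point to the
   values, the x-derivatives and the y-derivatives of p_1, ..., p_d there. *)
Definition from_slopes (d : nat)
    (F : ('I_d -> K) -> ('I_d -> K) -> ('I_d -> K) -> K)
    (p : 'I_d -> plane K -> K) z : K :=
  F (fun i => p i z) (fun i => partial_x (p i) z) (fun i => partial_y (p i) z).

End Web.

(* Main.v *)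
Require Import Defs.
From HB Require Import structures.
From mathcomp Require Import all_boot all_order all_algebra.
From mathcomp Require Import all_classical all_reals all_analysis.
From mathcomp Require Import complex.
From mathcomp Require Import ring zify.

Import Order.TTheory GRing.Theory Num.Theory numFieldNormedType.Exports.

Local Open Scope classical_set_scope.
Local Open Scope ring_scope.

(** At a fixed point [z] the [i]-th symmetry equation says that
      [∂x α2 + (∂y α2 - ∂x α1) t - ∂y α1 t^2 = α1 ∂x p_i + α2 ∂y p_i]
    at [t = p_i].  Let [C] and [D] be the polynomials in [t], of degree less
    than [d], that take the values [∂x p_i] and [∂y p_i] at the [d] points
    [p_i]; their coefficients involve the slopes alone.  The system then says
    that the polynomial
      [∂x α2 + (∂y α2 - ∂x α1) t - ∂y α1 t^2 - α1 C - α2 D]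
    vanishes at [d] distinct points.  Its degree is less than [d] because
    [d >= 3], so it vanishes identically, and the vanishing of its
    coefficients of degree [0, ..., d - 1] is, up to sign, the normalized
    system: the functions of index [d - k] are the coefficients of degree [k]
    of [C] and [D].

    The slopes are distinct at [z] ([slopes_distinct]) because the resultant
    of [P] and its derivative lies in the ideal that they generate: at a double
    root of [P] it would vanish ([resultant_common_root]). *)

(** * Lagrange interpolation *)

Section Interpolation.
Context {F : fieldType} {d : nat}.
Implicit Types (v u : 'I_d -> F) (q : {poly F}).

Definition interpolant v u : {poly F} :=
  \sum_i u i *: \prod_(j | j != i) ((v i - v j)^-1 *: ('X - (v j)%:P)).

Lemma interpolantE v u i : injective v -> (interpolant v u).[v i] = u i.
Proof.
move=> v_inj; rewrite horner_sum (bigD1 i) //= hornerZ horner_prod.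
rewrite [X in u i * X]big1 => [|j ji]; last first.
  rewrite hornerZ hornerXsubC mulVf // subr_eq0.
  by apply: contra ji => /eqP /v_inj ->.
rewrite mulr1 big1 ?addr0 // => j ji.
rewrite hornerZ horner_prod (bigD1 i) ?(eq_sym i) //=.
by rewrite hornerZ hornerXsubC subrr !(mulr0, mul0r).
Qed.

Lemma size_interpolant v u : (size (interpolant v u) <= d)%N.
Proof.
apply: (leq_trans (size_sum _ _ _)); apply/bigmax_leqP => i _.
apply: (leq_trans (size_scale_leq _ _)).
apply: (leq_trans (size_poly_prod_leq _ _)).
rewrite leq_subLR -addn1.
apply: (@leq_trans (\sum_(j | j != i) 2 + 1)%N).
  rewrite leq_add2r; apply: leq_sum => j _.
  by apply: (leq_trans (size_scale_leq _ _)); rewrite size_XsubC.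
rewrite sum_nat_const (cardC1 i) card_ord.
by have := ltn_ord i; lia.
Qed.

Lemma poly_eq0_at_nodes v q : injective v -> (size q <= d)%N ->
  (forall i, q.[v i] = 0) <-> q = 0.
Proof.
move=> v_inj szq; split=> [q0|-> i]; last by rewrite horner0.
apply: (roots_geq_poly_eq0 (rs := codom v)).
- by apply/allP => _ /codomP[i ->]; apply/eqP.
- by rewrite map_inj_uniq ?enum_uniq.
- by rewrite size_codom card_ord.
Qed.

(** The equivalence of the two systems at one point, with the derivatives of
    the unknown functions replaced by arbitrary scalars. *)
Lemma quadratic_system_coef (v ux uy : 'I_d -> F) (a1 a2 e0 e1 e2 : F) :
  (3 <= d)%N -> injective v ->
  let C := interpolant v ux in
  let D := interpolant v uy in
  (forall i, - a1 * ux i - a2 * uy i + e0 + e1 * v i - e2 * v i ^+ 2 = 0) <->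
  [/\ - e0 + C`_0 * a1 + D`_0 * a2 = 0,
      - e1 + C`_1 * a1 + D`_1 * a2 = 0,
      e2 + C`_2 * a1 + D`_2 * a2 = 0
    & forall k, (3 <= k < d)%N -> C`_k * a1 + D`_k * a2 = 0].
Proof.
move=> hd v_inj C D.
pose Q := Poly [:: - e0; - e1; e2] + (a1 *: C + a2 *: D).
have coefQ k : Q`_k = [:: - e0; - e1; e2]`_k + C`_k * a1 + D`_k * a2.
  by rewrite !coefD coef_Poly !coefZ addrA; congr (_ + _ + _); rewrite mulrC.
have szQ : (size Q <= d)%N.
  rewrite (leq_trans (size_polyD _ _))// geq_max (leq_trans (size_Poly _))//=.
  rewrite (leq_trans (size_polyD _ _))// geq_max.
  by rewrite !(leq_trans (size_scale_leq _ _)) ?size_interpolant.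
have QvE i : Q.[v i] =
    - (- a1 * ux i - a2 * uy i + e0 + e1 * v i - e2 * v i ^+ 2).
  rewrite !hornerD !hornerZ !interpolantE // horner_Poly /=.
  by ring.
apply: (iff_trans (B := forall i, Q.[v i] = 0)).
  split=> h i; first by rewrite QvE h oppr0.
  by apply: oppr_inj; rewrite -QvE h oppr0.
rewrite (poly_eq0_at_nodes _ _ v_inj szQ); split=> [Q0|[h0 h1 h2 h]].
  have Qk0 k : Q`_k = 0 by rewrite Q0 coef0.
  split; [have := Qk0 0%N|have := Qk0 1%N|have := Qk0 2%N|];
    rewrite ?coefQ //.
  move=> [|[|[|k]]] // _.
  by have := Qk0 k.+3; rewrite coefQ /= nth_nil add0r.
apply/polyP => k; rewrite coef0.
have [dk|kd] := leqP d k; first by rewrite nth_default // (leq_trans szQ).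
rewrite coefQ; case: k kd => [|[|[|k]]] kd //=.
by rewrite nth_nil add0r; apply: h; rewrite kd.
Qed.

End Interpolation.

(** * Distinctness of the slopes *)

(** The resultant is a combination [u P + w Q] with polynomial coefficients;
    apply [f] to that identity and evaluate at [x]. *)
Lemma resultant_common_root (A : comNzRingType) (B : comNzRingType)
    (f : {rmorphism A -> B}) (P Q : {poly A}) (x : B) :
  (1 < size P)%N -> (1 < size Q)%N ->
  (map_poly f P).[x] = 0 -> (map_poly f Q).[x] = 0 -> f (resultant P Q) = 0.
Proof.
move=> szP szQ Px Qx.
have [[u w] /= _ E] := resultant_in_ideal szP szQ.
have := congr1 (fun q => (map_poly f q).[x]) E.
by rewrite /= map_polyC hornerC rmorphD !rmorphM /= hornerD !hornerM Px Qx
  !mulr0 addr0.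
Qed.

Section Slopes.
Context {K : numFieldType}.

(** Functions with values in [K] form a ring with zero divisors, but a positive
    multiple of a nonzero function is still nonzero, as a pointwise check
    shows; so differentiation lowers the degree by exactly one. *)
Lemma size_deriv_fct (T : pointedType) (P : {poly (T -> K)}) (n : nat) :
  size P = n.+1 -> size P^`() = n.
Proof.
case: n => [|n] szP.
  by have /size1_polyC -> : (size P <= 1)%N; rewrite ?szP // derivC size_poly0.
apply/eqP; rewrite eqn_leq; apply/andP; split.
  by rewrite -ltnS -szP; apply: lt_size_deriv; rewrite -size_poly_eq0 szP.
rewrite ltnNge; apply/negP => /leq_sizeP /(_ n (leqnn n)).
rewrite coef_deriv => lead0.
have : lead_coef P == 0.
  apply/eqP/funext => z; have /(congr1 (fun f : T -> K => f z)) := lead0.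
  rewrite lead_coefE szP /= => /eqP.
  have fct_mulrn (f : T -> K) m : (f *+ m) z = f z *+ m.
    by elim: m => [|m IH]; rewrite ?mulr0n // !mulrSr -IH.
  by rewrite fct_mulrn mulrn_eq0 /= => /eqP.
by rewrite lead_coef_eq0 -size_poly_eq0 szP.
Qed.

(** If two slopes agreed at [z], their common value would be a double root of
    [P] evaluated at [z], hence a root of the derivative as well, and the
    resultant would vanish at [z]. *)
Lemma slopes_distinct (d : nat) (U : set (plane K))
    (P : {poly (plane K -> K)}) (p : 'I_d -> plane K -> K) (z : plane K) :
  (2 <= d)%N -> implicit_web d U P -> slopes U P p -> U z ->
  injective (fun i => p i z).
Proof.
move=> hd [_ szP _ resP] [_ facP] Uz i j pij.
apply/eqP/negPn/negP => ij.
pose ev := fun a : plane K -> K => a z.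
have ev_zmod : zmod_morphism ev by [].
have ev_mon : monoid_morphism ev by [].
pose evB := GRing.isZmodMorphism.Build _ _ ev ev_zmod.
pose evM := GRing.isMonoidMorphism.Build _ _ ev ev_mon.
pose evR : {rmorphism (plane K -> K) -> K} := HB.pack ev evB evM.
have /eqP[] := resP z Uz.
(* The two equal linear factors are set apart from the others. *)
have mapE : map_poly evR P =
  ('X - (p i z)%:P) * (('X - (p i z)%:P) *
    (P`_d z *: \prod_(k | (k != i) && (k != j)) ('X - (p k z)%:P))).
  rewrite [LHS](facP z Uz) (bigD1 i) //= (bigD1 j) 1?eq_sym //= -pij.
  by rewrite -!scalerAr.
apply: (@resultant_common_root _ _ evR P P^`() (p i z)).
- by rewrite szP; lia.
- by rewrite (size_deriv_fct _ P d szP).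
- by rewrite mapE hornerM hornerXsubC subrr mul0r.
- rewrite -deriv_map mapE derivM derivXsubC mul1r hornerD !hornerM.
  by rewrite hornerXsubC subrr !mul0r addr0.
Qed.

End Slopes.

(** * The normalized system *)

Theorem mainTheorem2 (R : realType) (d : nat) (hd : (3 <= d)%N) :
  exists G H : nat -> ('I_d -> R[i]) -> ('I_d -> R[i]) -> ('I_d -> R[i]) -> R[i],
    forall (U : set (plane R[i])) (P : {poly (plane R[i] -> R[i])})
           (p : 'I_d -> plane R[i] -> R[i]),
      implicit_web d U P -> slopes U P p ->
      let g k := from_slopes (G k) p in
      let h k := from_slopes (H k) p in
      forall a1 a2 : plane R[i] -> R[i],
        analytic_on U a1 -> analytic_on U a2 ->
        ((forall z, U z -> forall i : 'I_d, symmetry_eq (p i) a1 a2 z) <->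
         (forall z, U z -> normalized_system d g h a1 a2 z)).
Proof.
exists (fun k v ux uy => (interpolant v ux)`_(d - k)).
exists (fun k v ux uy => (interpolant v uy)`_(d - k)).
move=> U P p webP slP g h a1 a2 _ _.
suff pt z : U z -> (forall i, symmetry_eq (p i) a1 a2 z) <->
    normalized_system d g h a1 a2 z.
  by split=> H z Uz; apply/(pt z Uz); apply: H.
move=> Uz.
have p_inj := slopes_distinct d U P p z (ltnW hd) webP slP Uz.
rewrite /symmetry_eq /normalized_system /g /h /from_slopes.
rewrite (quadratic_system_coef _ _ _ _ _ _ _ _ hd p_inj).
rewrite subnn !subKn ?(ltnW hd) ?(ltnW (ltnW hd)) // opprB.
split=> -[h0 h1 h2 hk]; split=> // k kd; first by apply: hk; lia.
by have := hk (d - k)%N; rewrite subKn; [apply|]; lia.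
Qed.
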